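(* For any interval $\mathcal{I}\subseteq[-1/2,1/2)$ and any $f\in\mathbb{F}_q[X]$ of degree $d$ with $p\nmid d$, \[N_{\mathcal{I}}(f,\psi)=(d-1)|\mathcal{I}|+O\left(\frac{d}{\log d}\right),\] where the implied constant depends at most on $q$.
   Context: $p$ odd prime, $q$ a power of $p$; $\mathrm{tr}_n:\mathbb{F}_{q^n}\to\mathbb{F}_p$ absolute trace; $\psi$ a fixed nontrivial additive character of $\mathbb{F}_p$; $S_n(f,\psi)=\sum_{x\in\mathbb{F}_{q^n}}\psi(\mathrm{tr}_nf(x))$; $L(u,f,\psi)=\exp(\sum_{n\ge1}S_n(f,\psi)u^n/n)=\prod_{j=1}^{d-1}(1-\sqrt q e^{2\pi i\theta_j(f,\psi)}u)$ with $\theta_j(f,\psi)\in[-1/2,1/2)$. $N_{\mathcal{I}}(f,\psi)=\#\{1\le j\le d-1:\theta_j(f,\psi)\in\mathcal{I}\}$, and $|\mathcal{I}|$ is the length of $\mathcal{I}$. *)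

(* Defs.v *)
From HB Require Import structures.
From mathcomp Require Import all_boot all_order all_algebra all_field.
From mathcomp Require Import all_classical all_reals all_analysis.
From mathcomp Require Import complex.
Set Implicit Arguments. Unset Strict Implicit. Unset Printing Implicit Defensive.
Import Order.TTheory GRing.Theory Num.Theory.
Local Open Scope ring_scope.

(* The element of the prime field 'F_p represented by y, when y lies in the
   prime subfield of a field E of characteristic p (0 otherwise). *)
Definition to_Fp (p : nat) (E : finFieldType) (y : E) : 'F_p :=
  odflt 0 [pick a : 'F_p | ((a : nat)%:R : E) == y].

(* Absolute trace of E = F_{p^m} (m = k*n for F_{q^n}, q = p^k), as an element of E
   (it lies in the prime subfield):  sum_{i < m} x^(p^i). *)
Definition abs_trace (p m : nat) (E : finFieldType) (x : E) : E :=
  \sum_(i < m) x ^+ (p ^ i).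

Definition nontrivial_add_char (R : rcfType) (p : nat) (psi : 'F_p -> complex R) :=
  (forall a b, psi (a + b) = psi a * psi b) /\ exists a, psi a != 1.

(* S_n(f, psi) = sum_{x in F_{q^n}} psi(tr_n f(x)), where E = F_{q^n}, q = p^k,
   iota : F_q -> F_{q^n}. *)
Definition expsum (R : rcfType) (p k n : nat) (F E : finFieldType)
  (iota : {rmorphism F -> E}) (psi : 'F_p -> complex R) (f : {poly F}) : complex R :=
  \sum_(x : E) psi (to_Fp p (abs_trace p (k * n) (map_poly iota f).[x])).

Definition e2pi (R : realType) (t : R) : complex R :=
  (cos (2 * pi * t) +i* sin (2 * pi * t))%C.

Definition N_I (R : realType) (m : nat) (theta : 'I_m -> R) (I : interval R) : nat :=
  #|[set j : 'I_m | theta j \in I]|.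

Definition weil_root (R : realType) (q : nat) (t : R) : complex R :=
  ((Num.sqrt (q%:R : R) +i* 0)%C * e2pi t).

(* Main.v *)
Require Import Defs.
From HB Require Import structures.
From mathcomp Require Import all_boot all_order all_algebra all_field.
From mathcomp Require Import all_classical all_reals all_analysis.
From mathcomp Require Import complex.
From mathcomp Require Import ring lra zify.
Import Order.TTheory GRing.Theory Num.Theory.
Local Open Scope ring_scope.

Set Implicit Arguments. Unset Strict Implicit. Unset Printing Implicit Defensive.

(* The values of psi have modulus at most 1, so |S_n| <= q^n, that is
   |sum_j e(n theta_j)| <= q^(n/2). What remains is an Erdos-Turan type inequality.
   Let K(t) = |sum_(n < L) e(n t)|^4, cut the circle into G = 4 L cells with centres y_h,
   and let W be the constant sum_h K(t - y_h). The functions K(t - y_h) / W form a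
   nonnegative partition of unity whose Fourier coefficients vanish from degree 2 L on.
   Positivity of K bounds the number of angles in each cell by O(d / L + q^L), and the
   fourth power decay of K away from 0 makes the total error of replacing the indicator of
   the first m cells by the partition functions attached to them O(1) times that number,
   without a loss of log L (a kernel with second power decay would lose it). The smoothed
   count is m d / G + O(L q^L), and L of order log d balances both errors. *)

(** * Elementary bounds for sine and cosine *)

Section Trigonometry.
Import numFieldNormedType.Exports.
Variable R : realType.
Implicit Types x t : R.

Lemma cos_ge_half x : `|x| <= pi / 4 -> 1 / 2 <= cos x.
Proof.
move=> hx; rewrite -cos_norm.
have pi0 := @pi_gt0 R; have x0 := normr_ge0 x.
(* The double angle formula at [pi / 4] gives [2 * c ^ 2 = 1], hence [c >= 1 / 2]. *)
have hq : 1 / 2 <= cos (pi / 4 : R).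
  have c0 : 0 <= cos (pi / 4 : R) by apply: cos_ge0_pihalf; apply/andP; split; lra.
  have := cos_pihalf R; have -> : pi / 2 = (pi / 4) *+ 2 :> R by rewrite -mulr_natr; lra.
  rewrite cos_mulr2n -mulr_natr expr2 => h; nra.
apply: le_trans hq _.
have [->//|ne] := eqVneq `|x| (pi / 4).
rewrite ltW// ltr_cos ?in_itv /=; first by rewrite lt_neqAle ne hx.
- by apply/andP; split; lra.
- by apply/andP; split; lra.
Qed.

(** On [[0, pi / 4]] the mean value theorem gives slope at least [1 / 2]; doubling the angle reaches
    [pi / 2] at the cost of a factor 2. *)
Lemma sin_ge_quarter x : 0 <= x <= pi / 2 -> x / 4 <= sin x.
Proof.
have pi0 := @pi_gt0 R.
have H : forall y : R, 0 <= y <= pi / 4 -> y / 2 <= sin y.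
  move=> y /andP[y0 y1]; have [<-|yn] := eqVneq 0 y; first by rewrite sin0 mul0r.
  have y_gt0 : 0 < y by rewrite lt_neqAle yn.
  have sinC : {within `[0, y], continuous (@sin R)}%classic.
    by apply: continuous_subspaceT => z; exact: continuous_sin.
  have [c] := MVT y_gt0 (fun z _ => is_derive_sin z) sinC.
  rewrite in_itv /= => /andP[c0 c1].
  rewrite sin0 !subr0 => ->.
  have : 1 / 2 <= cos c by apply: cos_ge_half; rewrite ger0_norm; lra.
  by move=> hc; nra.
move=> /andP[x0 x1].
have h1 : x / 2 / 2 <= sin (x / 2) by apply: H; apply/andP; split; lra.
have h2 : 1 / 2 <= cos (x / 2) by apply: cos_ge_half; rewrite ger0_norm; lra.
have -> : sin x = (cos (x / 2) * sin (x / 2)) *+ 2.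
  by rewrite -sin_mulr2n; congr sin; rewrite -mulr_natr; lra.
by rewrite -mulr_natr; nra.
Qed.

Lemma sin_pi_ge t : 0 <= t <= 1 / 2 -> t / 2 <= sin (pi * t).
Proof.
move=> /andP[t0 t1]; have p2 := @pi_ge2 R.
have h : pi * t / 4 <= sin (pi * t).
  by apply: sin_ge_quarter; apply/andP; split; nra.
by apply: le_trans h; nra.
Qed.

End Trigonometry.

(** * The Jackson kernel: size and Fourier expansion *)

Section Kernel.
Variables (R : realType) (L : nat).
Implicit Types t x y : R.

Definition dirichlet_cos t : R := \sum_(n < L) cos (2 * pi * n%:R * t).
Definition dirichlet_sin t : R := \sum_(n < L) sin (2 * pi * n%:R * t).

(* The square modulus of the square of \sum_(n < L) e(n t). *)
Definition jackson t : R := (dirichlet_cos t ^+ 2 + dirichlet_sin t ^+ 2) ^+ 2.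

Lemma jackson_ge0 t : 0 <= jackson t. Proof. exact: sqr_ge0. Qed.

Lemma jackson0 : jackson 0 = L%:R ^+ 4.
Proof.
rewrite /jackson /dirichlet_cos /dirichlet_sin.
under eq_bigr do rewrite mulr0 cos0.
under [X in _ + X ^+ 2]eq_bigr do rewrite mulr0 sin0.
rewrite big1_eq sumr_const card_ord expr0n /= addr0; ring.
Qed.


Lemma jacksonN t : jackson (- t) = jackson t.
Proof.
rewrite /jackson; have -> : dirichlet_cos (- t) = dirichlet_cos t.
  by apply: eq_bigr => n _; rewrite mulrN cosN.
have -> : dirichlet_sin (- t) = - dirichlet_sin t.
  by rewrite -sumrN; apply: eq_bigr => n _; rewrite mulrN sinN.
by rewrite sqrrN.
Qed.

(** Multiplied by [2 * sin (pi * t)], both Dirichlet sums telescope. The square modulus of the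
    exponential sum times [sin (pi * t) ^ 2] is thus [sin (pi * L * t) ^ 2]. *)
Lemma jackson_sin_le t : jackson t * sin (pi * t) ^+ 4 <= 1.
Proof.
set s := sin (pi * t).
pose b : R := pi * (2 * L%:R - 1) * t.
have hc : 2 * s * dirichlet_cos t = sin b + s.
  rewrite /b /dirichlet_cos; elim: (L) => [|n IH].
    rewrite big_ord0 !mulr0 [pi * (0 - 1) * t](_ : _ = - (pi * t)); last by ring.
    by rewrite sinN addNr.
  rewrite big_ord_recr /= mulrDr IH.
  have -> : pi * (2 * n.+1%:R - 1) * t = 2 * pi * n%:R * t + pi * t.
    by rewrite -natr1; ring.
  have -> : pi * (2 * n%:R - 1) * t = 2 * pi * n%:R * t - pi * t by ring.
  by rewrite sinB sinD /s; ring.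
have hs : 2 * s * dirichlet_sin t = cos (pi * t) - cos b.
  rewrite /b /dirichlet_sin; elim: (L) => [|n IH].
    rewrite big_ord0 !mulr0 [pi * (0 - 1) * t](_ : _ = - (pi * t)); last by ring.
    by rewrite cosN subrr.
  rewrite big_ord_recr /= mulrDr IH.
  have -> : pi * (2 * n.+1%:R - 1) * t = 2 * pi * n%:R * t + pi * t.
    by rewrite -natr1; ring.
  have -> : pi * (2 * n%:R - 1) * t = 2 * pi * n%:R * t - pi * t by ring.
  by rewrite cosB cosD /s; ring.
have h1 := cos2Dsin2 (pi * t); have h2 := cos2Dsin2 b.
set F := dirichlet_cos t ^+ 2 + dirichlet_sin t ^+ 2.
have hF : F * s ^+ 2 = (2 - 2 * cos (pi * t + b)) / 4.
  rewrite cosD; transitivity (((2 * s * dirichlet_cos t) ^+ 2 +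
    (2 * s * dirichlet_sin t) ^+ 2) / 4); first by rewrite /F; field.
  rewrite hc hs; move: h1 h2; rewrite -/s => h1 h2; lra.
have -> : jackson t * s ^+ 4 = (F * s ^+ 2) ^+ 2 by rewrite /jackson -/F; ring.
have c1 := cos_le1 (pi * t + b); have c2 := cos_geN1 (pi * t + b).
by apply: exprn_ile1; rewrite hF; lra.
Qed.

(** If [u] is the distance from [t] to the nearest integer, then [sin (pi * t) >= u / 2]. Adding the
    bounds for both ends spares a case split later. *)
Lemma jackson_le t : 0 < t < 1 ->
  jackson t <= 16 / t ^+ 4 + 16 / (1 - t) ^+ 4.
Proof.
move=> /andP[t0 t1].
have H u : 0 < u -> u / 2 <= sin (pi * t) -> jackson t <= 16 / u ^+ 4.
  move=> u0 hu; rewrite ler_pdivlMr ?exprn_gt0//.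
  have := jackson_sin_le t; set K := jackson t; have K0 : 0 <= K := jackson_ge0 t.
  have : (u / 2) ^+ 4 <= sin (pi * t) ^+ 4.
    by rewrite lerXn2r ?nnegrE//; lra.
  move=> h1 h2; have : K * (u / 2) ^+ 4 <= 1.
    by apply: le_trans h2; rewrite ler_wpM2l.
  by rewrite expr_div_n mulrA ler_pdivrMr ?exprn_gt0// mul1r => /le_trans; apply; lra.
have [h|h] := lerP t (1 / 2).
  apply: (le_trans (H t t0 _)); first by apply: sin_pi_ge; lra.
  by rewrite lerDl divr_ge0 ?exprn_ge0//; lra.
apply: (le_trans (H (1 - t) _ _)); first by lra.
  have -> : sin (pi * t) = sin (pi * (1 - t)).
    by rewrite [pi * (1 - t)](_ : _ = - (pi * t) + pi) ?sinDpi ?sinN ?opprK//; ring.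
  by apply: sin_pi_ge; lra.
by rewrite lerDr divr_ge0 ?exprn_ge0//; lra.
Qed.

(** All phases [2 * pi * n * t] with [n < L] stay within [pi / 4] of 0, so every cosine is at least
    [1 / 2] and nothing cancels. *)
Lemma jackson_ge t : `|t| <= 1 / (8 * L%:R) -> L%:R ^+ 4 / 16 <= jackson t.
Proof.
move=> ht.
have hc : L%:R / 2 <= dirichlet_cos t.
  have -> : L%:R / 2 = \sum_(n < L) (1 / 2) :> R.
    by rewrite sumr_const card_ord -mulr_natl; ring.
  apply: ler_sum => n _; apply: cos_ge_half.
  have L0 : (0 : R) < L%:R by rewrite ltr0n (leq_ltn_trans _ (ltn_ord n)).
  have p0 := @pi_gt0 R.
  rewrite !normrM (@ger0_norm _ 2)// (ger0_norm (ltW p0)) ger0_norm//.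
  have : n%:R * `|t| <= 1 / 8.
    apply: (@le_trans _ _ (L%:R * (1 / (8 * L%:R)))); last first.
      by rewrite mulrA mulr1 invfM mulrCA divff ?gt_eqF//; lra.
    by rewrite ler_pM// ler_nat ltnW.
  by move=> h; rewrite -!mulrA; nra.
have L0 : (0 : R) <= L%:R by [].
have : L%:R ^+ 2 / 4 <= dirichlet_cos t ^+ 2 + dirichlet_sin t ^+ 2.
  have := sqr_ge0 (dirichlet_sin t); nra.
move=> h; rewrite /jackson (_ : L%:R ^+ 4 / 16 = (L%:R ^+ 2 / 4) ^+ 2); last by field.
by rewrite lerXn2r ?nnegrE ?addr_ge0 ?divr_ge0 ?sqr_ge0.
Qed.

Definition pairsum (u : 'I_L * 'I_L) : nat := (u.1 + u.2)%N.

(** The squared exponential sum has one term of frequency [pairsum u] for each pair [u]; its square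
    modulus then matches [u] with [v]. *)
Lemma jackson_expand t : jackson t =
  \sum_u \sum_v cos (2 * pi * ((pairsum u)%:R - (pairsum v)%:R) * t).
Proof.
pose a (u : 'I_L * 'I_L) := 2 * pi * (pairsum u)%:R * t.
transitivity ((\sum_u cos (a u)) ^+ 2 + (\sum_u sin (a u)) ^+ 2).
  have -> : \sum_u cos (a u) = dirichlet_cos t ^+ 2 - dirichlet_sin t ^+ 2.
    rewrite 2!expr2 !big_distrlr /= !pair_big /= -sumrB; apply: eq_bigr => u _.
    by rewrite /a /pairsum natrD mulrDr mulrDl cosD.
  have -> : \sum_u sin (a u) = 2 * dirichlet_cos t * dirichlet_sin t.
    transitivity (dirichlet_sin t * dirichlet_cos t + dirichlet_cos t * dirichlet_sin t).
      rewrite !big_distrlr /= !pair_big /= -big_split /=; apply: eq_bigr => u _.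
      by rewrite /a /pairsum natrD mulrDr mulrDl sinD.
    by ring.
  by rewrite /jackson; ring.
rewrite 2!expr2 !big_distrlr /= -big_split /=; apply: eq_bigr => u _.
rewrite -big_split /=; apply: eq_bigr => v _.
by rewrite -cosB /a; congr cos; ring.
Qed.

(** The constant Fourier coefficient of [jackson L]: the additive energy of the integers below
    [L]. *)
Definition balanced_pairs : nat :=
  \sum_(u : 'I_L * 'I_L) \sum_(v : 'I_L * 'I_L | pairsum u == pairsum v) 1.

(** Three entries of a solution of [a + b = c + d] determine the fourth. *)
Lemma balanced_pairs_le : (balanced_pairs <= L ^ 3)%N.
Proof.
rewrite /balanced_pairs pair_big_dep /= sum1_card.
pose f (w : ('I_L * 'I_L) * ('I_L * 'I_L)) := (w.1, w.2.1).
rewrite -(@card_in_imset _ _ f); last first.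
  move=> [[a b] [c d]] [[a' b'] [c' d']]; rewrite !unfold_in /pairsum /= => /eqP h1 /eqP h2.
  rewrite /f => -[ea eb ec]; rewrite ea eb ec in h1 *.
  by do 2 congr pair; apply: ord_inj; lia.
by apply: leq_trans (max_card _) _; rewrite !card_prod !card_ord; lia.
Qed.

End Kernel.

(** * Sums over the grid of cell centres *)

Section Grid.
Variable R : realType.
Implicit Types t x y : R.

Lemma sin_addM2pi x (u v : nat) : sin (x + 2 * pi * (u%:R - v%:R)) = sin x.
Proof.
rewrite -(periodicn (@sinD2pi R) v).
have -> : x + 2 * pi * (u%:R - v%:R) + pi *+ 2 *+ v = x + pi *+ 2 *+ u.
  by rewrite -[pi *+ 2 *+ v]mulr_natr -[pi *+ 2 *+ u]mulr_natr -[pi *+ 2]mulr_natr; ring.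
by rewrite (periodicn (@sinD2pi R)).
Qed.

(** A full geometric sum whose ratio is a nontrivial [G]-th root of unity. It telescopes after
    multiplication by [2 * sin b], with [b] half the angle step. *)
Lemma sum_cos_grid (G u v : nat) x : u != v -> (u < G)%N -> (v < G)%N ->
  \sum_(h < G) cos (x - 2 * pi * (u%:R - v%:R) * (h%:R / G%:R)) = 0.
Proof.
move=> uv uG vG.
have G0 : (0 : R) < G%:R by rewrite ltr0n; lia.
have sin_gt0 (a b : nat) : (a < b < G)%N -> 0 < sin (pi * (b%:R - a%:R) / G%:R : R).
  move=> ab; apply: sin_gt0_pi; have pi0 := @pi_gt0 R.
  have h : (0 : R) < b%:R - a%:R by rewrite subr_gt0 ltr_nat; lia.
  rewrite divr_gt0 ?mulr_gt0//= ltr_pdivrMr// ltr_pM2l//.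
  by rewrite -natrB ?ltr_nat; lia.
pose b : R := pi * (v%:R - u%:R) / G%:R.
have sb : sin b != 0.
  have [h|h|h] := ltngtP u v; last by rewrite h eqxx in uv.
  - by rewrite gt_eqF// sin_gt0//; lia.
  - rewrite [b](_ : _ = - (pi * (u%:R - v%:R) / G%:R)); last by rewrite /b; field; lra.
    by rewrite sinN oppr_eq0 gt_eqF// sin_gt0//; lia.
have tel (n : nat) : 2 * sin b * (\sum_(h < n) cos (x - 2 * pi * (u%:R - v%:R) * (h%:R / G%:R)))
    = sin (x - b + 2 * b * n%:R) - sin (x - b).
  elim: n => [|n IH]; first by rewrite big_ord0 !mulr0 addr0 subrr.
  rewrite big_ord_recr /= mulrDr IH.
  have -> : x - 2 * pi * (u%:R - v%:R) * (n%:R / G%:R) = x + 2 * b * n%:R.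
    by rewrite /b; field; lra.
  have -> : x - b + 2 * b * n%:R = x + 2 * b * n%:R - b by ring.
  have -> : x - b + 2 * b * n.+1%:R = x + 2 * b * n%:R + b by rewrite -natr1; ring.
  by rewrite [sin (_ - b)]sinB [sin (x + _ + b)]sinD; ring.
have := tel G; have -> : 2 * b * G%:R = 2 * pi * (v%:R - u%:R).
  by rewrite /b; field; lra.
rewrite sin_addM2pi subrr => /eqP; rewrite mulf_eq0 mulf_eq0 (negbTE sb) orbF.
by rewrite pnatr_eq0 /= => /eqP.
Qed.

(* Centring the cells keeps every grid point of another cell at distance at least
   r / (2 G) from the points of a cell lying r cells away, also around the circle. *)
Definition cell_center (G : nat) (h : 'I_G) : R := (h%:R + 1 / 2) / G%:R.

(** All frequencies [pairsum u - pairsum v] are below the grid size in absolute value, so only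
    balanced pairs survive and the sum is independent of [t]. *)
Lemma jackson_grid_sum (L : nat) t :
  \sum_(h < 4 * L) jackson L (t - cell_center h) =
    (4 * L * balanced_pairs L)%N%:R.
Proof.
under eq_bigr do rewrite jackson_expand.
rewrite exchange_big /= /balanced_pairs big_distrr /= natr_sum.
apply: eq_bigr => u _; rewrite exchange_big /= big_distrr /= natr_sum [RHS]big_mkcond /=.
apply: eq_bigr => v _; case: ifPn => [/eqP <-|uv].
  under eq_bigr do rewrite subrr mulr0 mul0r cos0.
  by rewrite sumr_const card_ord muln1.
have L0 : (0 < L)%N by rewrite (leq_ltn_trans _ (ltn_ord u.1)).
rewrite -[RHS](@sum_cos_grid (4 * L) (pairsum u) (pairsum v)
   (2 * pi * ((pairsum u)%:R - (pairsum v)%:R) * (t - 1 / 2 / (4 * L)%:R)))//; last 2 first.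
- by have := ltn_ord u.1; have := ltn_ord u.2; rewrite /pairsum; lia.
- by have := ltn_ord v.1; have := ltn_ord v.2; rewrite /pairsum; lia.
apply: eq_bigr => h _; congr cos; rewrite /cell_center; field.
by rewrite pnatr_eq0; lia.
Qed.

(** At a cell centre the grid sum contains [jackson L 0], and its other terms are nonnegative. *)
Lemma balanced_pairs_ge (L : nat) : (0 < L)%N ->
  L%:R ^+ 4 <= (4 * L * balanced_pairs L)%N%:R :> R.
Proof.
move=> L0; have G0 : (0 < 4 * L)%N by lia.
rewrite -(jackson_grid_sum L (cell_center (Ordinal G0))) (bigD1 (Ordinal G0)) //=.
rewrite subrr jackson0 lerDl; apply: sumr_ge0 => h _; exact: jackson_ge0.
Qed.

Lemma sum_inv_sq_le (n : nat) : \sum_(i < n) ((i.+1)%:R ^+ 2)^-1 <= 2 :> R.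
Proof.
case: n => [|n]; first by rewrite big_ord0.
(* The sharper bound [2 - 1 / (n + 1)] is what makes the induction close. *)
suff : \sum_(i < n.+1) ((i.+1)%:R ^+ 2)^-1 <= 2 - (n.+1%:R)^-1 :> R.
  by move=> /le_trans; apply; rewrite gerBl invr_ge0.
elim: n => [|n IH]; first by rewrite big_ord1 /= expr1n invr1; lra.
rewrite big_ord_recr /=; apply: (le_trans (lerD IH (lexx _))).
rewrite -[n.+2]addn1 natrD; set a : R := n.+1%:R.
have a0 : 0 < a by rewrite ltr0n.
have -> : 2 - a^-1 + ((a + 1) ^+ 2)^-1 = 2 - (a + 1)^-1 - (a * (a + 1) ^+ 2)^-1.
  by field; rewrite !gt_eqF//; lra.
by rewrite gerBl invr_ge0 mulr_ge0 ?sqr_ge0// ltW.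
Qed.

Lemma sum_inv_sq_inj_le (G : nat) (P : pred 'I_G) (g : 'I_G -> nat) :
  {in P &, injective g} -> (forall c, P c -> 0 < g c <= G)%N ->
  \sum_(c | P c) ((g c)%:R ^+ 2)^-1 <= 2 :> R.
Proof.
move=> gi gP; apply: le_trans (sum_inv_sq_le G).
(* Since [0 < g c <= G] under [P], the default value [c] is never taken there. *)
pose f (c : 'I_G) : 'I_G := insubd c (g c).-1.
have fE c : P c -> f c = (g c).-1 :> nat.
  by move=> /gP h; rewrite val_insubd; case: ifP => //; lia.
have -> : \sum_(c | P c) ((g c)%:R ^+ 2)^-1 = \sum_(c in P) (((f c).+1)%:R ^+ 2)^-1 :> R.
  by apply: eq_bigr => c Pc; rewrite fE// prednK//; case/andP: (gP c Pc).
have fi : {in P &, injective f}.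
  move=> a b Pa Pb /(congr1 val) /=; rewrite !fE// => h; apply: gi => //.
  by have := gP a Pa; have := gP b Pb; lia.
have -> : \sum_(c in P) (((f c).+1)%:R ^+ 2)^-1 =
    \sum_(c in f @: P) ((c.+1)%:R ^+ 2)^-1 :> R by rewrite big_imset.
by rewrite big_mkcond /=; apply: ler_sum => c _; case: ifP.
Qed.

End Grid.

(** * Discrepancy of points with small exponential sums *)

Section Discrepancy.
Variable R : realType.

(** The error is the mass [X] that points inside [A] send out minus the mass [Y] that points outside
    send in. Both lie between 0 and the same bound, so their difference costs that bound only
    once. *)
Lemma partition_smoothing (M G : nat) (kappa : 'I_M -> 'I_G)
    (k : 'I_M -> 'I_G -> R) (w : 'I_G -> 'I_G -> R) (A : pred 'I_G) (B : R) :
  (forall j h, 0 <= k j h) -> (forall j, \sum_h k j h = 1) ->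
  (forall c h, 0 <= w c h) ->
  (forall j h, A (kappa j) -> ~~ A h -> k j h <= w (kappa j) h) ->
  (forall j h, ~~ A (kappa j) -> A h -> k j h <= w h (kappa j)) ->
  (forall c, #|[pred j | kappa j == c]|%:R <= B) ->
  `| #|[pred j | A (kappa j)]|%:R - \sum_(h | A h) \sum_j k j h | <=
    B * \sum_(c | A c) \sum_(h | ~~ A h) w c h.
Proof.
move=> k0 k1 w0 kw kw' hB; set W := \sum_(c | A c) \sum_(h | ~~ A h) w c h.
pose X := \sum_(j | A (kappa j)) \sum_(h | ~~ A h) k j h.
pose Y := \sum_(j | ~~ A (kappa j)) \sum_(h | A h) k j h.
have -> : #|[pred j | A (kappa j)]|%:R - \sum_(h | A h) \sum_j k j h = X - Y.
  have -> : #|[pred j | A (kappa j)]|%:R =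
      \sum_(j | A (kappa j)) \sum_(h | A h) k j h + X.
    rewrite -big_split /= -sum1_card natr_sum; apply: eq_bigr => j _.
    by rewrite -(k1 j) (bigID A).
  have -> : \sum_(h | A h) \sum_j k j h =
      \sum_(j | A (kappa j)) \sum_(h | A h) k j h + Y.
    by rewrite exchange_big /= (bigID (fun j => A (kappa j))).
  by ring.
have fibre (P : pred 'I_G) (F : 'I_G -> R) : (forall c, P c -> 0 <= F c) ->
    \sum_(j | P (kappa j)) F (kappa j) <= B * \sum_(c | P c) F c.
  move=> F0; rewrite (partition_big kappa P) //= mulr_sumr; apply: ler_sum => c Pc.
  rewrite (eq_bigr (fun=> F c)); last by move=> j /andP[_ /eqP ->].
  rewrite sumr_const -mulr_natl; apply: ler_wpM2r; first exact: F0.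
  apply: le_trans _ (hB c); rewrite ler_nat; apply: subset_leq_card.
  by apply/fintype.subsetP => j; rewrite !inE => /andP[].
have hX : 0 <= X <= B * W.
  apply/andP; split; first by do 2 apply: sumr_ge0 => ? _.
  apply: (@le_trans _ _ (\sum_(j | A (kappa j)) \sum_(h | ~~ A h) w (kappa j) h)); last first.
    by apply: (fibre A (fun c => \sum_(h | ~~ A h) w c h)) => c _; apply: sumr_ge0.
  by apply: ler_sum => j Aj; apply: ler_sum => h Ah; exact: kw.
have hY : 0 <= Y <= B * W.
  apply/andP; split; first by do 2 apply: sumr_ge0 => ? _.
  rewrite /W exchange_big /=.
  apply: (@le_trans _ _ (\sum_(j | ~~ A (kappa j)) \sum_(h | A h) w h (kappa j))); last first.
    by apply: (fibre (predC A) (fun c => \sum_(h | A h) w h c)) => c _; apply: sumr_ge0.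
  by apply: ler_sum => j Aj; apply: ler_sum => h Ah; exact: kw'.
by rewrite ler_norml; lra.
Qed.

Variables (M L : nat) (x : 'I_M -> R) (E : R).
Hypothesis L_gt0 : (0 < L)%N.
Hypothesis E_ge0 : 0 <= E.
Hypothesis expsum_le : forall (u v : nat) (y : R), u != v ->
  (u <= 2 * L)%N -> (v <= 2 * L)%N ->
  `| \sum_j cos (2 * pi * (u%:R - v%:R) * (x j - y)) | <= E.

(** In the expansion of the kernel each balanced pair contributes exactly [M], and each of the at
    most [L ^ 4] others at most [E]. *)
Lemma jackson_point_sum (y : R) :
  `| \sum_j jackson L (x j - y) - M%:R * (balanced_pairs L)%:R | <= L%:R ^+ 4 * E.
Proof.
under eq_bigr do rewrite jackson_expand.
rewrite exchange_big /= /balanced_pairs natr_sum mulr_sumr -sumrB.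
apply: (le_trans (ler_norm_sum _ _ _)).
have -> : L%:R ^+ 4 * E = \sum_(u : 'I_L * 'I_L) \sum_(v : 'I_L * 'I_L) E.
  rewrite !sumr_const card_prod card_ord -!mulrnA -[RHS]mulr_natl; congr (_ * _).
  by rewrite -natrX; congr (_%:R); lia.
apply: ler_sum => u _; rewrite exchange_big /= natr_sum mulr_sumr [X in _ - X]big_mkcond /=.
rewrite -sumrB; apply: (le_trans (ler_norm_sum _ _ _)); apply: ler_sum => v _.
case: ifPn => [/eqP ->|uv].
  under eq_bigr do rewrite subrr mulr0 mul0r cos0.
  by rewrite sumr_const card_ord mulr1 subrr normr0.
rewrite subr0; apply: expsum_le => //.
- by have := ltn_ord u.1; have := ltn_ord u.2; rewrite /pairsum; lia.
- by have := ltn_ord v.1; have := ltn_ord v.2; rewrite /pairsum; lia.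
Qed.

Variable kappa : 'I_M -> 'I_(4 * L).
Hypothesis kappaP : forall j,
  (kappa j)%:R / (4 * L)%:R <= x j < ((kappa j)%:R + 1) / (4 * L)%:R.

Let Lr_gt0 : (0 : R) < L%:R. Proof. by rewrite ltr0n. Qed.

Lemma kappa_range j :
  (kappa j)%:R <= 4 * L%:R * x j < (kappa j)%:R + 1.
Proof.
have := kappaP j; rewrite natrM ler_pdivrMr ?ltr_pdivlMr ?mulr_gt0//.
by rewrite [x j * _]mulrC.
Qed.

(** Points of a cell are within [1 / (8 L)] of its centre, where the kernel is at least
    [L ^ 4 / 16]; positivity discards all other points. *)
Lemma cell_count_le c :
  #|[pred j | kappa j == c]|%:R <= 16 * (M%:R / L%:R + E) :> R.
Proof.
have Lr0 := Lr_gt0.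
have := jackson_point_sum (cell_center R c).
rewrite ler_norml => /andP[_]; rewrite lerBlDr => h.
have h1 : #|[pred j | kappa j == c]|%:R * (L%:R ^+ 4 / 16) <=
    \sum_j jackson L (x j - cell_center R c).
  rewrite mulr_natl -sumr_const big_mkcond /=; apply: ler_sum => j _.
  case: ifP => [/eqP kj|_]; last exact: jackson_ge0.
  apply: jackson_ge; have := kappa_range j; rewrite kj /cell_center natrM => hj.
  have -> : x j - (c%:R + 1 / 2) / (4 * L%:R) =
      (4 * L%:R * x j - (c%:R + 1 / 2)) / (4 * L%:R) by field; lra.
  rewrite normrM normfV (@ger0_norm _ (4 * _)); last by lra.
  have -> : 1 / (8 * L%:R) = (1 / 2) / (4 * L%:R) :> R by field; lra.
  by rewrite ler_pM2r ?invr_gt0 ?mulr_gt0// ler_norml; lra.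
have hb : (balanced_pairs L)%:R <= L%:R ^+ 3 :> R.
  by rewrite -natrX ler_nat balanced_pairs_le.
have h2 : M%:R * (balanced_pairs L)%:R <= M%:R * L%:R ^+ 3 :> R by rewrite ler_wpM2l.
have h3 := le_trans h1 (le_trans h (lerD (lexx _) h2)).
have L4 : (0 : R) < L%:R ^+ 4 / 16 by rewrite divr_gt0 ?exprn_gt0.
rewrite -(ler_pM2r L4); apply: (le_trans h3); rewrite le_eqVlt; apply/orP; left.
by apply/eqP; field; lra.
Qed.

(* For c < m <= h, both h - c and its cyclic complement 4 L - (h - c) have the form
   u + v - 1 with u depending only on c and v only on h; bounding (u + v - 1)^4 below
   by u^2 v^2 makes the sum over all such pairs factor. *)
Definition offset_weight (m : nat) (c h : nat) : R :=
  16 * 8 ^+ 4 * (((m - c)%:R ^+ 2)^-1 * ((h.+1 - m)%:R ^+ 2)^-1 +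
           (c.+1%:R ^+ 2)^-1 * ((4 * L - h)%:R ^+ 2)^-1).

Lemma jackson_offset_le (m c h : nat) (t : R) : (c < m)%N -> (m <= h)%N -> (h < 4 * L)%N ->
  h%:R - c%:R - 1 / 2 <= 4 * L%:R * t <= h%:R - c%:R + 1 / 2 ->
  jackson L t / L%:R ^+ 4 <= offset_weight m c h.
Proof.
move=> cm mh hL.
have a0 : (0 < m - c)%N by lia.
have b0 : (0 < h.+1 - m)%N by lia.
have d0 : (0 < 4 * L - h)%N by lia.
have ch : (c <= h)%N by lia.
have ab : (m - c)%:R + (h.+1 - m)%:R - 1 = h%:R - c%:R :> R.
  by rewrite -natrD (_ : _ + _ = h - c + 1)%N; [rewrite natrD addrK natrB|lia].
move=> ht; have Lr0 := Lr_gt0.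
have r1 : 1 <= h%:R - c%:R :> R by rewrite -natrB ?ler1n; lia.
have r2 : 1 <= 4 * L%:R - (h%:R - c%:R) :> R.
  by rewrite -natrM -natrB -?natrB ?ler1n; lia.
set r : R := h%:R - c%:R in ht r1 r2.
(* Both [r] and [4 L - r] are at least 1, so the half cell of uncertainty at most halves either
   distance. *)
have t0 : r / (8 * L%:R) <= t by rewrite ler_pdivrMr; lra.
have t1 : (4 * L%:R - r) / (8 * L%:R) <= 1 - t by rewrite ler_pdivrMr; lra.
have p0 : 0 < r / (8 * L%:R) by rewrite divr_gt0; lra.
have p1 : 0 < (4 * L%:R - r) / (8 * L%:R) by rewrite divr_gt0; lra.
(* Serves [t] and [1 - t] alike. For [a, b >= 1] the number [a + b - 1] is at least both [a] and
   [b], so its square is at least [a * b]. *)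
have key (s T : R) (a b : nat) : 0 < s / (8 * L%:R) -> s / (8 * L%:R) <= T ->
    (0 < a)%N -> (0 < b)%N -> a%:R + b%:R - 1 <= s ->
    16 / T ^+ 4 / L%:R ^+ 4 <= 16 * 8 ^+ 4 * ((a%:R ^+ 2)^-1 * (b%:R ^+ 2)^-1).
  move=> s0 sT a_gt0 b_gt0 abs.
  have a1 : (1 : R) <= a%:R by rewrite ler1n.
  have b1 : (1 : R) <= b%:R by rewrite ler1n.
  have s_gt0 : 0 < s by lra.
  have abs4 : a%:R ^+ 2 * b%:R ^+ 2 <= s ^+ 4 :> R.
    have -> : s ^+ 4 = (s * s) ^+ 2 by ring.
    by rewrite -exprMn lerXn2r ?nnegrE ?mulr_ge0//; nra.
  have h1 : 16 / T ^+ 4 <= 16 / (s / (8 * L%:R)) ^+ 4.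
    rewrite ler_pM2l// lef_pV2 ?posrE ?exprn_gt0//; last by lra.
    by rewrite lerXn2r ?nnegrE; lra.
  have -> : 16 * 8 ^+ 4 * ((a%:R ^+ 2)^-1 * (b%:R ^+ 2)^-1) =
      16 * 8 ^+ 4 / (a%:R ^+ 2 * b%:R ^+ 2) :> R by rewrite -invfM.
  apply: (@le_trans _ _ (16 * 8 ^+ 4 / s ^+ 4)); last first.
    rewrite ler_pM2l ?mulr_gt0 ?exprn_gt0//.
    by rewrite lef_pV2 // posrE ?mulr_gt0 ?exprn_gt0 ?ltr0n.
  rewrite ler_pdivrMr ?exprn_gt0//; apply: (le_trans h1).
  by rewrite le_eqVlt; apply/orP; left; apply/eqP; field; lra.
have hj := @jackson_le R L t.
have : jackson L t / L%:R ^+ 4 <= (16 / t ^+ 4 + 16 / (1 - t) ^+ 4) / L%:R ^+ 4.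
  by rewrite ler_pM2r ?invr_gt0 ?exprn_gt0//; apply: hj; lra.
move=> /le_trans; apply; rewrite mulrDl /offset_weight mulrDr; apply: lerD.
- apply: key p0 t0 a0 b0 _.
  by rewrite ab.
- apply: key p1 t1 (ltn0Sn c) d0 _.
  by rewrite (natrB _ (ltnW hL)) natrM -natr1 /r; lra.
Qed.

(** Each of the two products splits into two sums of distinct inverse squares, each at most 2. The
    total [4 + 4] supplies the fifth factor 8. *)
Lemma offset_weight_sum (m : nat) : (m <= 4 * L)%N ->
  \sum_(c < 4 * L | (c < m)%N) \sum_(h < 4 * L | ~~ (h < m)%N) offset_weight m c h
    <= (16 * 8 ^+ 5).
Proof.
move=> mL.
have prod_le (P Q : pred 'I_(4 * L)) (f g : 'I_(4 * L) -> nat) :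
  {in P &, injective f} -> (forall c, P c -> 0 < f c <= 4 * L)%N ->
  {in Q &, injective g} -> (forall c, Q c -> 0 < g c <= 4 * L)%N ->
  \sum_(c | P c) \sum_(h | Q h) ((f c)%:R ^+ 2)^-1 * ((g h)%:R ^+ 2)^-1 <= 4 :> R.
  move=> fi fP gi gP; rewrite -big_distrlr /=.
  have -> : 4 = 2 * 2 :> R by ring.
  by apply: ler_pM; rewrite ?sumr_ge0 ?sum_inv_sq_inj_le // => i _; rewrite invr_ge0 sqr_ge0.
under eq_bigr do rewrite -mulr_sumr big_split /=.
rewrite -mulr_sumr big_split /=.
have -> : 16 * 8 ^+ 5 = 16 * 8 ^+ 4 * (4 + 4) :> R by ring.
rewrite ler_pM2l//; apply: lerD; apply: prod_le => [a b|a|a b|a].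
- by rewrite !unfold_in => ha hb e; apply: ord_inj; lia.
- by move=> ha; lia.
- by rewrite !unfold_in => ha hb e; apply: ord_inj; lia.
- by move=> ha; have := ltn_ord a; lia.
- by move=> _ _ [e]; apply: ord_inj.
- by move=> _; have := ltn_ord a; lia.
- by move=> _ _ e; have := ltn_ord a; have := ltn_ord b; move=> *; apply: ord_inj; lia.
- by move=> _; have := ltn_ord a; lia.
Qed.

Lemma prefix_discrepancy (m : nat) : (m <= 4 * L)%N ->
  `| #|[pred j | (kappa j < m)%N]|%:R - M%:R * (m%:R / (4 * L)%:R) | <=
    (16 ^+ 2 * 8 ^+ 5 + 4) * (M%:R / L%:R + L%:R * E).
Proof.
move=> mL.
have Lr0 := Lr_gt0.
set W : R := (4 * L * balanced_pairs L)%N%:R.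
have L4 : (0 : R) < L%:R ^+ 4 by rewrite exprn_gt0.
have W_ge : L%:R ^+ 4 <= W := balanced_pairs_ge R L_gt0.
have W_gt0 : 0 < W by apply: lt_le_trans W_ge.
pose k (j : 'I_M) (h : 'I_(4 * L)) : R := jackson L (x j - cell_center R h) / W.
have k_le j h : k j h <= jackson L (x j - cell_center R h) / L%:R ^+ 4.
  by rewrite ler_wpM2l ?jackson_ge0// lef_pV2 ?posrE.
have offset j (h : 'I_(4 * L)) :
    4 * L%:R * (cell_center R h - x j) = h%:R + 1 / 2 - 4 * L%:R * x j.
  by rewrite /cell_center natrM; field; lra.
have B0 : 0 <= 16 * (M%:R / L%:R + E) by rewrite mulr_ge0 ?addr_ge0 ?divr_ge0.
have smoothing : `| #|[pred j | (kappa j < m)%N]|%:R -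
    \sum_(h < 4 * L | (h < m)%N) \sum_j k j h| <=
    16 * (M%:R / L%:R + E) * (16 * 8 ^+ 5).
  apply: le_trans (ler_wpM2l B0 (offset_weight_sum mL)).
  apply: (@partition_smoothing M (4 * L) kappa k (fun c h => offset_weight m c h)
    (fun c => (c < m)%N)) => [j h|j|c h|j h jm hm|j h jm hm|c].
  - by rewrite divr_ge0 ?jackson_ge0// ltW.
  - by rewrite -mulr_suml jackson_grid_sum divff// gt_eqF.
  - by rewrite !(mulr_ge0, addr_ge0, invr_ge0, exprn_ge0).
  (* Here the cell [h] lies above the point, so evenness of the kernel is used to make the offset
     positive. *)
  - apply: le_trans (k_le j h) _; rewrite -jacksonN opprB.
    apply: jackson_offset_le => //; first by rewrite leqNgt.
    by have := kappa_range j; rewrite offset; lra.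
  - apply: le_trans (k_le j h) _.
    apply: jackson_offset_le => //; first by rewrite leqNgt.
    by have := kappa_range j; have := offset j h; lra.
  - exact: cell_count_le.
have main_term : `| \sum_(h < 4 * L | (h < m)%N) \sum_j k j h - M%:R * (m%:R / (4 * L)%:R) |
    <= 4 * L%:R * E.
  have const (c : R) : \sum_(h < 4 * L | (h < m)%N) c = m%:R * c.
    by rewrite -(big_ord_widen _ (fun=> c) mL) sumr_const card_ord mulr_natl.
  (* Since [W] is [4 L] times [balanced_pairs L], each of the [m] cells carries the expected share
     [M / (4 L)]. *)
  have -> : M%:R * (m%:R / (4 * L)%:R) =
      \sum_(h < 4 * L | (h < m)%N) (M%:R * (balanced_pairs L)%:R / W).
    have n0 : (balanced_pairs L)%:R != 0 :> R.
      by apply: contraTneq W_gt0; rewrite /W natrM => ->; rewrite mulr0 ltxx.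
    by rewrite const /W !natrM; field; rewrite n0 /=; lra.
  rewrite -sumrB; apply: (le_trans (ler_norm_sum _ _ _)).
  apply: (@le_trans _ _ (\sum_(h < 4 * L | (h < m)%N) E)).
    apply: ler_sum => h _; rewrite -mulr_suml -mulrBl normrM normfV (gtr0_norm W_gt0).
    rewrite ler_pdivrMr//; apply: (le_trans (jackson_point_sum _)).
    by rewrite mulrC ler_wpM2l.
  by rewrite const ler_wpM2r// -natrM ler_nat.
have E_le : E <= L%:R * E by rewrite ler_peMl// ler1n.
have ML0 : 0 <= M%:R / L%:R :> R by rewrite divr_ge0.
have -> : 16 ^+ 2 * 8 ^+ 5 + 4 = 16 * (16 * 8 ^+ 5) + 4 :> R by ring.
have K0 : (0 : R) <= 16 * 8 ^+ 5 by rewrite mulr_ge0 ?exprn_ge0.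
set K : R := 16 * 8 ^+ 5 in smoothing K0 *.
have bound := lerD smoothing main_term.
apply: le_trans (le_trans bound _); last first.
  move: smoothing main_term bound => _ _ _; nra.
by apply: le_trans (ler_normD _ _); rewrite subrKA.
Qed.

End Discrepancy.

(** * From character sums to sums over the angles *)

Section ExponentialSums.
Variable R : realType.

(** [psi 0] is idempotent, hence 0 or 1, and the [p]-th power of [psi a] is [psi 0]. *)
Lemma add_char_norm_le1 (p : nat) (psi : 'F_p -> complex R) (a : 'F_p) : prime p ->
  (forall a b, psi (a + b) = psi a * psi b) -> `|psi a| <= 1.
Proof.
move=> p_pr psiD; have p0 := prime_gt0 p_pr.
have psi0 : `|psi 0| <= 1.
  have [->|nz] := eqVneq (psi 0) 0; first by rewrite normr0.
  have : psi 0 * psi 0 = psi 0 * 1 by rewrite -psiD addr0 mulr1.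
  by move=> /(mulfI nz) ->; rewrite normr1.
have psiX n : psi (a *+ n.+1) = psi a ^+ n.+1.
  by elim: n => [|n IH]; rewrite ?expr1 // mulrS psiD IH -exprS.
rewrite -(expr_le1 p0)// -normrX -(prednK p0) -psiX prednK//.
by rewrite -mulr_natr pchar_Fp_0 ?mulr0.
Qed.

Lemma expsum_norm_le (p k n : nat) (F E : finFieldType) (iota : {rmorphism F -> E})
    (psi : 'F_p -> complex R) (f : {poly F}) : prime p ->
  (forall a b, psi (a + b) = psi a * psi b) ->
  `|expsum k n iota psi f| <= #|E|%:R.
Proof.
move=> p_pr psiD; apply: (le_trans (ler_norm_sum _ _ _)).
rewrite -sum1_card natr_sum; apply: ler_sum => x _; exact: add_char_norm_le1.
Qed.

Lemma weil_rootX (q n : nat) (t : R) : weil_root q t ^+ n =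
  (Num.sqrt q%:R ^+ n * cos (2 * pi * n%:R * t) +i*
   (Num.sqrt q%:R ^+ n * sin (2 * pi * n%:R * t)))%C.
Proof.
elim: n => [|n IH]; first by rewrite !expr0 mulr0 mul0r cos0 sin0 mulr1 mulr0.
rewrite exprS IH /weil_root /e2pi.
have -> : 2 * pi * n.+1%:R * t = 2 * pi * t + 2 * pi * n%:R * t by rewrite -natr1; ring.
by rewrite cosD sinD exprS; simpc; congr (_ +i* _)%C; ring.
Qed.

Lemma sum_complex (I : finType) (a b : I -> R) :
  \sum_j (a j +i* b j)%C = ((\sum_j a j) +i* (\sum_j b j))%C :> complex R.
Proof. by elim/big_rec3: _ => [//|j u v w _ ->]; simpc. Qed.

(** Dividing by the common modulus [q ^ (n / 2)] of the roots leaves [q ^ (n / 2)] as a bound for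
    both the cosine and the sine sum; shifting by [y] mixes the two, whence the factor 2. *)
Lemma angle_sum_le (q n M : nat) (theta : 'I_M -> R) (y : R) : (0 < q)%N ->
  `|\sum_j weil_root q (theta j) ^+ n| <= (q ^ n)%:R ->
  `|\sum_j cos (2 * pi * n%:R * (theta j - y))| <= 2 * Num.sqrt q%:R ^+ n.
Proof.
move=> q0; set s : R := Num.sqrt q%:R.
have s0 : 0 < s by rewrite sqrtr_gt0 ltr0n.
have sn0 : 0 < s ^+ n by rewrite exprn_gt0.
pose C := \sum_j cos (2 * pi * n%:R * theta j).
pose D := \sum_j sin (2 * pi * n%:R * theta j).
have -> : \sum_j weil_root q (theta j) ^+ n = (s ^+ n * C +i* (s ^+ n * D))%C.
  by rewrite !mulr_sumr -sum_complex; apply: eq_bigr => j _; exact: weil_rootX.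
have -> : (q ^ n)%:R = ((s ^+ n) ^+ 2)%:C%C :> complex R.
  by rewrite -exprM mulnC exprM sqr_sqrtr// -natrX rmorph_nat.
rewrite normc_def lecR /= => h.
have h2 : (s ^+ n * C) ^+ 2 + (s ^+ n * D) ^+ 2 <= ((s ^+ n) ^+ 2) ^+ 2.
  rewrite -[X in X <= _]sqr_sqrtr ?addr_ge0 ?sqr_ge0//.
  by rewrite lerXn2r ?nnegrE ?sqrtr_ge0 ?sqr_ge0.
have {h2} CD : C ^+ 2 + D ^+ 2 <= (s ^+ n) ^+ 2.
  rewrite -(ler_pM2l (exprn_gt0 2 sn0)); apply: le_trans h2.
  by rewrite mulrDr !exprMn.
have hC : `|C| <= s ^+ n.
  rewrite -(ler_pXn2r (ltn0Sn 1)) ?nnegrE ?normr_ge0 ?(ltW sn0)// real_normK ?num_real//.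
  by apply: le_trans CD; rewrite lerDl sqr_ge0.
have hD : `|D| <= s ^+ n.
  rewrite -(ler_pXn2r (ltn0Sn 1)) ?nnegrE ?normr_ge0 ?(ltW sn0)// real_normK ?num_real//.
  by apply: le_trans CD; rewrite lerDr sqr_ge0.
have -> : \sum_j cos (2 * pi * n%:R * (theta j - y)) =
    cos (2 * pi * n%:R * y) * C + sin (2 * pi * n%:R * y) * D.
  rewrite !mulr_sumr -big_split; apply: eq_bigr => j _ /=.
  by rewrite mulrBr cosB; ring.
apply: (le_trans (ler_normD _ _)); rewrite !normrM.
have -> : 2 * s ^+ n = s ^+ n + s ^+ n by ring.
by apply: lerD; rewrite -[leRHS]mul1r ler_pM ?cos_max ?sin_max.
Qed.

End ExponentialSums.

(** * From prefixes of cells to arbitrary intervals *)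

Lemma inner_cells_count (m1 m2 k G : nat) (b : bool) : (m1 <= m2)%N -> (k < G)%N ->
  (b -> m1 <= k <= m2)%N -> (b + (k < m1) <= (k < minn m2.+1 G))%N.
Proof. by case: b => ? ? h; [have := h isT|clear h]; lia. Qed.

Lemma outer_cells_count (m1 m2 k G : nat) (b : bool) : (k < G)%N ->
  (m1 < k < m2 -> b)%N -> ((k < m2) <= b + (k < minn m1.+1 G))%N.
Proof. by case: b; lia. Qed.

Section Interval.
Variables (R : realType) (M L : nat) (theta : 'I_M -> R) (Delta : R).
Hypothesis L_gt0 : (0 < L)%N.
Hypothesis theta_itv : forall j, theta j \in `[- (1/2), 1/2[.

Lemma grid_cell (z : R) : z \in `[- (1/2), 1/2[ -> exists c : 'I_(4 * L),
  c%:R / (4 * L)%:R <= z + 1 / 2 < (c%:R + 1) / (4 * L)%:R.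
Proof.
rewrite in_itv /= => /andP[z0 z1].
have G0 : (0 : R) < (4 * L)%:R by rewrite ltr0n; lia.
have y0 : 0 <= (4 * L)%:R * (z + 1 / 2) by rewrite mulr_ge0//; lra.
have := truncn_itv y0; set c := Num.truncn _ => /andP[c0 c1].
have cG : (c < 4 * L)%N.
  by rewrite -(ltr_nat R); apply: le_lt_trans c0 _; rewrite gtr_pMr//; lra.
exists (Ordinal cG); rewrite /= ler_pdivrMr// ltr_pdivlMr// [_ * (4 * L)%:R]mulrC.
by rewrite c0 natr1 c1.
Qed.

Variable kappa : 'I_M -> 'I_(4 * L).
Hypothesis kappaP : forall j,
  (kappa j)%:R / (4 * L)%:R <= theta j + 1 / 2 < ((kappa j)%:R + 1) / (4 * L)%:R.
Hypothesis prefix_le : forall m : nat, (m <= 4 * L)%N ->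
  `| #|[pred j | (kappa j < m)%N]|%:R - M%:R * (m%:R / (4 * L)%:R) | <= Delta.

Lemma interval_discrepancy (a b : R) (I : interval R) :
  - (1/2) <= a -> a <= b -> b <= 1/2 ->
  (forall z, z \in I -> a <= z <= b) -> (forall z, a < z < b -> z \in I) ->
  `| (N_I theta I)%:R - M%:R * (b - a) | <= 2 * Delta + M%:R / L%:R.
Proof.
move=> ha ab hb Iab abI.
have Lr0 : (0 : R) < L%:R by rewrite ltr0n.
have G0 : (0 : R) < (4 * L)%:R by rewrite ltr0n; lia.
(* In this coordinate the cells are unit intervals, and [m1], [m2] below are the cells of the two
   ends. *)
pose g (z : R) := (4 * L)%:R * (z + 1 / 2).
have g_le y z : (g y <= g z) = (y <= z) by rewrite /g ler_pM2l// lerD2r.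
have g_lt y z : (g y < g z) = (y < z) by rewrite /g ltr_pM2l// ltrD2r.
have gk j : (kappa j)%:R <= g (theta j) < (kappa j).+1%:R.
  have := kappaP j; rewrite ler_pdivrMr// ltr_pdivlMr// natr1.
  by rewrite /g [_ * (4 * L)%:R]mulrC.
have ga0 : 0 <= g a by rewrite /g mulr_ge0//; lra.
have gb0 : 0 <= g b by apply: le_trans ga0 _; rewrite g_le.
have gbG : g b <= (4 * L)%:R by rewrite /g ger_pMr//; lra.
have := truncn_itv ga0; set m1 := Num.truncn _ => /andP[a1 a2].
have := truncn_itv gb0; set m2 := Num.truncn _ => /andP[b1 b2].
have m12 : (m1 <= m2)%N.
  by rewrite -ltnS -(ltr_nat R); apply: le_lt_trans a1 (le_lt_trans _ b2); rewrite g_le.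
have m2G : (m2 <= 4 * L)%N by rewrite -(ler_nat R); apply: le_trans b1 gbG.
pose P m := #|[pred j | (kappa j < m)%N]|.
have kI_ge j : theta j \in I -> (m1 <= kappa j <= m2)%N.
  move=> /Iab /andP[t0 t1]; have /andP[k0 k1] := gk j; apply/andP; split.
    by rewrite -ltnS -(ltr_nat R); apply: le_lt_trans a1 (le_lt_trans _ k1); rewrite g_le.
  by rewrite -ltnS -(ltr_nat R); apply: le_lt_trans k0 (le_lt_trans _ b2); rewrite g_le.
have kI_lt j : (m1 < kappa j < m2)%N -> theta j \in I.
  move=> /andP[t0 t1]; have /andP[k0 k1] := gk j; apply: abI; apply/andP; split.
    by rewrite -g_lt; apply: lt_le_trans a2 (le_trans _ k0); rewrite ler_nat.
  by rewrite -g_lt; apply: lt_le_trans k1 (le_trans _ b1); rewrite ler_nat.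
have cardE (Q : pred 'I_M) : #|[pred j | Q j]| = \sum_j (Q j : nat).
  by rewrite -sum1_card big_mkcond; apply: eq_bigr => j _; rewrite unfold_in /=; case: (Q j).
have NE : N_I theta I = \sum_j ((theta j \in I) : nat) by rewrite /N_I cardsE cardE.
(* [m2] equals [4 L] when [b = 1 / 2]; the minimum keeps the prefix within the grid. Rounding both
   ends outwards, or inwards for [lo], costs two cells, at most [M / (2 L)]. *)
have up : (N_I theta I + P m1 <= P (minn m2.+1 (4 * L)))%N.
  rewrite NE /P !cardE -big_split /=.
  by apply: leq_sum => j _; apply: inner_cells_count m12 (ltn_ord _) (@kI_ge j).
have lo : (P m2 <= N_I theta I + P (minn m1.+1 (4 * L)))%N.
  rewrite NE /P !cardE -big_split /=.
  by apply: leq_sum => j _; apply: outer_cells_count (ltn_ord _) (@kI_lt j).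
have DL := prefix_le (leq_trans m12 m2G); have DR := prefix_le m2G.
have DL' := prefix_le (geq_minr m1.+1 (4 * L)).
have DR' := prefix_le (geq_minr m2.+1 (4 * L)).
have M0 : 0 <= M%:R / (4 * L)%:R :> R by rewrite divr_ge0.
have frac (m : nat) : M%:R * (m%:R / (4 * L)%:R) = M%:R / (4 * L)%:R * m%:R :> R by ring.
have main : M%:R * (b - a) = M%:R / (4 * L)%:R * (g b - g a).
  by rewrite /g; field; lra.
have cell : M%:R / L%:R = M%:R / (4 * L)%:R * 4 :> R by rewrite natrM; field; lra.
have c1 : (minn m1.+1 (4 * L))%:R <= g a + 1.
  apply: (@le_trans _ _ m1.+1%:R); first by rewrite ler_nat geq_minl.
  by rewrite -natr1 lerD2r.
have c2 : (minn m2.+1 (4 * L))%:R <= g b + 1.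
  apply: (@le_trans _ _ m2.+1%:R); first by rewrite ler_nat geq_minl.
  by rewrite -natr1 lerD2r.
have a3 : g a - 1 <= m1%:R by rewrite lerBlDr natr1 ltW.
have b3 : g b - 1 <= m2%:R by rewrite lerBlDr natr1 ltW.
move: DL DR DL' DR'; rewrite !frac main cell !ler_norml.
set rho := _ / _ in M0 *.
move: up lo; rewrite -(ler_nat R) -[(P m2 <= _)%N](ler_nat R) !natrD /P.
have := ler_wpM2l M0 c1; have := ler_wpM2l M0 c2.
have := ler_wpM2l M0 a3; have := ler_wpM2l M0 b3.
rewrite !mulrDr !mulrN !mulr1 => *; apply/andP; split; lra.
Qed.

End Interval.

(** If an end stuck out of [[l, u[], the midpoint [z] of the protruding piece would lie in the
    interval but not in [[l, u[]. *)
Lemma interval_endpoints (R : realType) (l u a b : R) (ba bb : bool) : a < b ->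
  {subset Interval (BSide ba a) (BSide bb b) <= `[l, u[} -> l <= a /\ b <= u.
Proof.
move=> ab sub.
have inner z : a < z < b -> z \in Interval (BSide ba a) (BSide bb b).
  by move=> /andP[h1 h2]; rewrite in_itv /= !lteifS.
split; rewrite leNgt; apply/negP => h.
- pose z := (a + Num.min l b) / 2.
  have zm : a < Num.min l b by rewrite lt_min h ab.
  have hl : Num.min l b <= l by rewrite ge_min lexx.
  have hb : Num.min l b <= b by rewrite ge_min lexx orbT.
  have /sub : z \in Interval (BSide ba a) (BSide bb b).
    by apply: inner; rewrite /z; lra.
  by rewrite in_itv /= /z; lra.
- pose z := (Num.max u a + b) / 2.
  have zm : Num.max u a < b by rewrite gt_max h ab.
  have hu : u <= Num.max u a by rewrite le_max lexx.
  have ha : a <= Num.max u a by rewrite le_max lexx orbT.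
  have /sub : z \in Interval (BSide ba a) (BSide bb b).
    by apply: inner; rewrite /z; lra.
  by rewrite in_itv /= /z; lra.
Qed.

(* L is about ln d / (4 ln q), so that q ^ L is at most q d^(1/4). *)
Lemma truncation_choice (R : realType) (q : nat) : (1 < q)%N ->
  exists C : R, 0 <= C /\ forall d : nat, (2 <= d)%N -> exists L : nat, (0 < L)%N /\
    d%:R / L%:R + L%:R * (q ^ L)%:R <= C * d%:R / ln d%:R.
Proof.
move=> q1; pose lq : R := ln q%:R.
have q0 : (0 : R) < q%:R by rewrite ltr0n ltnW.
have lq0 : 0 < lq by rewrite ln_gt0 // ltr1n.
have C0 : 0 <= 4 * lq + 4 * q%:R * (1 + lq^-1).
  by rewrite addr_ge0 ?mulr_ge0 ?addr_ge0 ?invr_ge0 ?ltW.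
exists (4 * lq + 4 * q%:R * (1 + lq^-1)); split=> // d d2.
have d0 : (0 : R) < d%:R by rewrite ltr0n; lia.
pose y : R := ln d%:R / 4.
have y0 : 0 < y by rewrite divr_gt0 ?ln_gt0 ?ltr1n.
(* With [e = expR y] the fourth root of [d], both [L] and [q ^ L] are [O(e)], and
   [e ^ 2 <= e ^ 4 / y] because [y <= e <= e ^ 2]. *)
have dE : d%:R = expR y ^+ 4 by rewrite -expRM_natl /y mulrC divfK ?lnK ?posrE.
have lnd : ln d%:R = 4 * y by rewrite /y; lra.
(* The successor makes [L] positive and larger than [y / lq], which bounds [d / L]. *)
exists (Num.truncn (y / lq)).+1; split => //.
have := truncn_itv (divr_ge0 (ltW y0) (ltW lq0)); set L := (Num.truncn _).+1.
move=> /andP[L1 L2].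
have {}L1 : L%:R <= y / lq + 1 by rewrite -natr1 lerD2r.
have L0 : (0 : R) < L%:R by rewrite ltr0n.
set e := expR y in dE.
have ye : y <= e by apply: le_trans (expR_ge1Dx y); rewrite lerDr.
have oe : 1 <= e by apply: le_trans (expR_ge1Dx y); rewrite lerDl ltW.
have qL : (q ^ L)%:R <= q%:R * e.
  rewrite natrX -{1}[q%:R]lnK ?posrE// -expRM_natl -/lq.
  apply: (@le_trans _ _ (expR (lq + y))); last by rewrite expRD lnK ?posrE.
  rewrite ler_expR; apply: (@le_trans _ _ ((y / lq + 1) * lq)).
    by rewrite ler_pM2r.
  by rewrite mulrDl divfK ?gt_eqF// mul1r addrC.
have first : d%:R / L%:R <= 4 * lq * (d%:R / ln d%:R).
  rewrite lnd ler_pdivrMr// (_ : _ * L%:R = d%:R * (lq * L%:R / y)); last first.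
    by field; rewrite gt_eqF.
  apply: ler_peMr; first exact: ltW.
  rewrite ler_pdivlMr// mul1r.
  by move: L2; rewrite ltr_pdivrMr// mulrC => /ltW.
have second : L%:R * (q ^ L)%:R <= 4 * q%:R * (1 + lq^-1) * (d%:R / ln d%:R).
  have hL : L%:R <= (1 + lq^-1) * e.
    apply: le_trans L1 _; rewrite mulrDl mul1r addrC lerD//.
    by rewrite mulrC ler_wpM2l// invr_ge0 ltW.
  have hd : e ^+ 2 <= 4 * (d%:R / ln d%:R).
    have -> : 4 * (d%:R / ln d%:R) = e ^+ 4 / y.
      by rewrite lnd dE; field; rewrite gt_eqF.
    rewrite ler_pdivlMr// (_ : e ^+ 4 = e ^+ 2 * e ^+ 2); last by ring.
    rewrite ler_wpM2l ?sqr_ge0//; apply: le_trans ye _.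
    by rewrite expr2 ler_peMl// (le_trans ler01).
  apply: (@le_trans _ _ ((1 + lq^-1) * e * (q%:R * e))); first by rewrite ler_pM.
  rewrite (_ : _ * e * _ = q%:R * (1 + lq^-1) * e ^+ 2); last by ring.
  rewrite (_ : 4 * q%:R * _ * _ = q%:R * (1 + lq^-1) * (4 * (d%:R / ln d%:R))); last by ring.
  by rewrite ler_wpM2l// mulr_ge0 ?addr_ge0 ?invr_ge0 ?ltW.
by rewrite -mulrA mulrDl lerD.
Qed.

(** * The estimate for the angles of the L-function *)

Theorem theorem4p2 (R : realType) (p k : nat) :
  prime p -> odd p -> (0 < k)%N ->
  exists C : R, forall (F : finFieldType) (E : nat -> finFieldType)
    (iota : forall n : nat, {rmorphism F -> E n})
    (psi : 'F_p -> complex R) (d : nat) (f : {poly F})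
    (theta : 'I_(d.-1) -> R) (a b : R) (ba bb : bool),
  p \in [pchar F] -> #|F| = (p ^ k)%N ->
  (forall n, (0 < n)%N -> #|E n| = (p ^ k) ^ n)%N ->
  nontrivial_add_char psi ->
  (2 <= d)%N -> size f = d.+1 -> ~~ (p %| d)%N ->
  (* theta_1, ..., theta_{d-1} in [-1/2,1/2) are the angles of the reciprocal roots
     of L(u, f, psi) = prod_j (1 - sqrt q e(theta_j) u), i.e. (taking logarithms)
     S_n(f, psi) = - sum_j (sqrt q e(theta_j))^n for all n >= 1 *)
  (forall j, theta j \in `[- (1/2), 1/2[) ->
  (forall n, (0 < n)%N ->
     @expsum R p k n F (E n) (iota n) psi f =
     - \sum_(j < d.-1) (weil_root (p ^ k)%N (theta j)) ^+ n) ->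
  let I := Interval (BSide ba a) (BSide bb b) in
  a <= b -> {subset I <= `[- (1/2), 1/2[} ->
  `| (N_I theta I)%:R - (d.-1)%:R * (b - a) | <= C * d%:R / ln (d%:R : R).
Proof.
move=> p_pr _ k0; set q := (p ^ k)%N.
have q1 : (1 < q)%N by rewrite -(expn0 p) ltn_exp2l ?prime_gt1.
have q0 := ltnW q1.
have [C0 [C0_ge0 HC0]] := truncation_choice R q1.
pose K : R := 16 ^+ 2 * 8 ^+ 5 + 4.
have K0 : 0 <= K by rewrite addr_ge0 ?mulr_ge0 ?exprn_ge0.
(* [4 * K] covers two prefix errors [Delta] with [B = 2 q ^ L], and 1 the rounding of the ends. *)
exists ((4 * K + 1) * C0) => F E iota psi d f theta a b ba bb _ _ cardE [psiD _] d2 _ _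
  theta_itv weil I ab subI.
have [L [L0 HL]] := HC0 d d2; set M := d.-1.
have ln0 : 0 < ln d%:R :> R by rewrite ln_gt0// ltr1n.
pose B : R := 2 * (q ^ L)%:R.
have B0 : 0 <= B by rewrite mulr_ge0.
have cos_sum n y : (0 < n)%N -> (n <= 2 * L)%N ->
    `|\sum_j cos (2 * pi * n%:R * (theta j - y))| <= B.
  move=> n0 nL; apply: (@le_trans _ _ (2 * Num.sqrt q%:R ^+ n)).
    apply: angle_sum_le => //; rewrite -normrN -weil// -cardE//.
    exact: expsum_norm_le.
  have s1 : 1 <= Num.sqrt q%:R :> R by rewrite -[leLHS]sqrtr1 ler_wsqrtr// ler1n.
  rewrite /B; have -> : (q ^ L)%:R = Num.sqrt q%:R ^+ (2 * L) :> R.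
    by rewrite exprM sqr_sqrtr// natrX.
  by rewrite ler_wpM2l// ler_weXn2l.
have expsum_le (u v : nat) y : u != v -> (u <= 2 * L)%N -> (v <= 2 * L)%N ->
    `|\sum_j cos (2 * pi * (u%:R - v%:R) * (theta j + 1 / 2 - y))| <= B.
  wlog uv : u v / (v < u)%N => [wl uv uL vL|_ uL vL].
    have [h|h|h] := ltngtP v u; first exact: wl.
      rewrite (eq_bigr (fun j => cos (2 * pi * (v%:R - u%:R) * (theta j + 1 / 2 - y)))).
        by apply: wl => //; rewrite eq_sym.
      by move=> j _; rewrite -cosN; congr cos; ring.
    by rewrite h eqxx in uv.
  (* The translation by [1 / 2], which moves the angles into [[0, 1)], is absorbed into [y]. *)
  rewrite (eq_bigr (fun j => cos (2 * pi * (u - v)%:R * (theta j - (y - 1 / 2))))).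
    by apply: cos_sum; lia.
  by move=> j _; congr cos; rewrite natrB ?(ltnW uv)//; ring.
have /fin_all_exists[kappa kappaP] : forall j, exists c : 'I_(4 * L),
    c%:R / (4 * L)%:R <= theta j + 1 / 2 < (c%:R + 1) / (4 * L)%:R.
  by move=> j; apply: grid_cell.
pose Delta : R := K * (M%:R / L%:R + L%:R * B).
have prefix m : (m <= 4 * L)%N -> `| #|[pred j | (kappa j < m)%N]|%:R
    - M%:R * (m%:R / (4 * L)%:R) | <= Delta.
  by move=> mL; apply: (@prefix_discrepancy R M L (fun j => theta j + 1 / 2)).
have ML : M%:R / L%:R <= d%:R / L%:R :> R.
  by rewrite ler_wpM2r ?invr_ge0// ler_nat leq_pred.
have ML0 : 0 <= M%:R / L%:R :> R by rewrite divr_ge0.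
have tail : 2 * Delta + M%:R / L%:R <= (4 * K + 1) * C0 * d%:R / ln d%:R.
  rewrite -2!mulrA; apply: (@le_trans _ _ ((4 * K + 1) *
    (d%:R / L%:R + L%:R * (q ^ L)%:R))); last first.
    by rewrite ler_wpM2l ?addr_ge0 ?mulr_ge0// mulrA.
  have t0 : 0 <= L%:R * (q ^ L)%:R :> R by rewrite mulr_ge0.
  have := ler_wpM2l K0 ML; have := mulr_ge0 K0 (le_trans ML0 ML).
  rewrite /Delta /B [L%:R * (2 * _)]mulrCA; move: ML t0.
  set x := d%:R / _; set m := M%:R / _; set t := L%:R * _.
  by clearbody K x m t => *; lra.
have Iab z : z \in I -> a <= z <= b.
  by rewrite in_itv /= => /andP[/lteifW -> /lteifW ->].
have abI z : a < z < b -> z \in I.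
  by move=> /andP[h1 h2]; rewrite in_itv /= !lteifS.
have [ltab|] := ltP a b.
  have [ha hb] := interval_endpoints ltab subI.
  by apply: le_trans tail; apply: (interval_discrepancy L0 kappaP prefix).
move=> ba_le; have {ba_le} eab : a = b by apply/eqP; rewrite eq_le ab ba_le.
(* A degenerate interval is one point or empty. If it is empty, the inclusion does not locate [a],
   and the count is 0 directly. *)
have [aI|aI] := boolP (a \in I).
  have := subI _ aI; rewrite in_itv /= => /andP[ha hb].
  apply: le_trans tail; apply: (interval_discrepancy L0 kappaP prefix) => //.
  by rewrite -eab ltW.
have -> : N_I theta I = 0%N.
  apply/eqP; rewrite cards_eq0; apply/eqP/setP => j; rewrite !inE.
  apply: contraNF aI => jI; have := Iab _ jI; rewrite -eab -eq_le => /eqP ->.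
  exact: jI.
rewrite eab subrr mulr0 subr0 normr0; apply: le_trans tail.
by rewrite addr_ge0 ?mulr_ge0 ?addr_ge0 ?mulr_ge0.
Qed.
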